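(* Let $A$ be a Nakayama algebra and $M$ an indecomposable $A$-module. If $\operatorname{Ext}^1_A(M,M)\neq 0$, then $\operatorname{Ext}^i_A(M,M)\neq 0$ for all $i\geq 1$.
   Context: All algebras are finite dimensional algebras over a field $K$, and modules are finitely generated right modules. A finite dimensional algebra $A$ is a Nakayama algebra if every indecomposable projective left module and every indecomposable projective right module is uniserial, i.e. has a unique composition series. *)

(* Defs.v *)
From HB Require Import structures.
From mathcomp Require Import all_boot all_order all_algebra all_field.
From mathcomp Require Import boolp classical_sets.
From mathcomp Require Import freeg.

Set Implicit Arguments.
Unset Strict Implicit.
Unset Printing Implicit Defensive.

Import GRing.Theory.

Local Open Scope classical_set_scope.
Local Open Scope ring_scope.

Section Modules.

Variable R : nzRingType.
Implicit Types M N P : lmodType R.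

Definition finitely_generated M : Prop :=
  exists s : seq M, forall x : M,
  exists a : 'I_(size s) -> R, x = \sum_i a i *: s`_i.

Definition submodule M (S : set M) : Prop :=
  S 0 /\ forall (a : R) (u v : M), S u -> S v -> S (a *: u + v).

Definition indecomposable M : Prop :=
  (exists x : M, x <> 0) /\
  forall S T : set M, submodule S -> submodule T ->
    S `&` T = [set 0] -> [set u + v | u in S & v in T] = setT ->
    S = [set 0] \/ T = [set 0].

(* [S] is a maximal proper submodule of [T], i.e. the quotient [T / S] is
   a simple module. *)
Definition maximal_submodule M (S T : set M) : Prop :=
  [/\ submodule S, submodule T, S `<` T &
      forall U : set M, submodule U -> S `<=` U -> U `<=` T -> U = S \/ U = T].

(* Increasing from [[set 0]] to [setT]; the default value [set0] is not a
   submodule, so the empty sequence is excluded. *)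
Definition composition_series M (s : seq (set M)) : Prop :=
  [/\ head set0 s = [set 0],
      last set0 s = setT &
      forall i : nat, (i.+1 < size s)%N ->
        maximal_submodule (nth set0 s i) (nth set0 s i.+1)].

Definition uniserial M : Prop :=
  exists! s : seq (set M), composition_series s.

Definition projective P : Prop :=
  forall (M N : lmodType R) (g : {linear M -> N}) (f : {linear P -> N}),
    range g = setT -> exists h : {linear P -> M}, g \o h =1 f.

Record projective_resolution M : Type := ProjectiveResolution {
  res_mod :> nat -> lmodType R;
  res_diff : forall n : nat, {linear res_mod n.+1 -> res_mod n};
  res_aug : {linear res_mod 0%N -> M};
  res_projective : forall n : nat, projective (res_mod n);
  res_aug_surj : range res_aug = setT;
  res_exact0 : range (res_diff 0%N) = [set x | res_aug x = 0];
  res_exactS : forall n : nat,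
    range (res_diff n.+1) = [set x | res_diff n x = 0]
}.

Section Cohomology.

Variables (M N : lmodType R) (P : projective_resolution M).

Definition cocycle (n : nat) (f : {linear P n -> N}) : Prop :=
  forall x, f (res_diff P n x) = 0.

Definition coboundary (n : nat) : {linear P n -> N} -> Prop :=
  match n with
  | 0%N => fun f => forall x, f x = 0
  | m.+1 => fun f =>
      exists g : {linear P m -> N}, forall x, f x = g (res_diff P m x)
  end.

(* The [n]-th cohomology group of the complex [Hom (P, N)] is nonzero. *)
Definition cohomology_neq0 (n : nat) : Prop :=
  exists f : {linear P n -> N}, cocycle f /\ ~ coboundary f.

End Cohomology.

(* [Ext^n (M, N) != 0].  By [projective_resolution_exists] and [Ext_neq0P]
   below, any projective resolution of [M] may be used. *)
Definition Ext_neq0 (n : nat) M N : Prop :=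
  exists P : projective_resolution M, cohomology_neq0 N P n.

End Modules.

(* Left [A]-modules are [lmodType A]; right [A]-modules are modules over the
   converse ring, [lmodType A^c], in which [a *: x] stands for [x a]. *)
Definition nakayama (K : fieldType) (A : falgType K) : Prop :=
  (forall P : lmodType A, finitely_generated P -> projective P ->
     indecomposable P -> uniserial P) /\
  (forall P : lmodType A^c, finitely_generated P -> projective P ->
     indecomposable P -> uniserial P).

Section Kernel.

Variables (R : nzRingType) (U V : lmodType R) (f : {linear U -> V}).

Definition kernel_pred : {pred U} := fun x => f x == 0.

Fact kernel_submod_closed : submod_closed kernel_pred.
Proof.
split=> [|a u v]; first by rewrite unfold_in linear0.
by rewrite !unfold_in linearP => /eqP-> /eqP->; rewrite scaler0 addr0.
Qed.

HB.instance Definition _ :=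
  GRing.isSubmodClosed.Build R U kernel_pred kernel_submod_closed.

Record kernel := Kernel { kernel_val :> U; _ : kernel_val \in kernel_pred }.

HB.instance Definition _ := [isSub for kernel_val].
HB.instance Definition _ := [Choice of kernel by <:].
HB.instance Definition _ := [SubChoice_isSubLmodule of kernel by <:].

End Kernel.

Section Resolutions.

Variable R : nzRingType.
Implicit Types L M N P : lmodType R.

Lemma projective_lift P L M N (g : {linear L -> M}) (k : {linear M -> N})
    (f : {linear P -> M}) : projective P ->
  range g = [set x | k x = 0] -> (forall x, k (f x) = 0) ->
  {h : {linear P -> L} | forall x, g (h x) = f x}.
Proof.
move=> projP exg kf; apply: cid.
have kg x : g x \in kernel_pred k.
  by apply/eqP; move/seteqP: exg => [gk _]; apply: gk; exists x.
have kf' x : f x \in kernel_pred k by apply/eqP.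
pose g0 x := Kernel (kg x); pose f0 x := Kernel (kf' x).
have g0P : linear g0 by move=> a u v; apply: val_inj; rewrite /= linearP.
have f0P : linear f0 by move=> a u v; apply: val_inj; rewrite /= linearP.
pose g1 : {linear L -> kernel k} :=
  HB.pack g0 (GRing.isLinear.Build _ _ _ _ g0 g0P).
pose f1 : {linear P -> kernel k} :=
  HB.pack f0 (GRing.isLinear.Build _ _ _ _ f0 f0P).
have sg : range g1 = setT.
  apply/seteqP; split=> // -[y ky] _.
  move/seteqP: exg => [_ kg']; have [x _ xy] := kg' y (eqP ky).
  by exists x => //; apply: val_inj.
by have [h hE] := projP _ _ g1 f1 sg; exists h => x; rewrite [LHS](congr1 val (hE x)).
Qed.

Lemma fglift_linear (T : choiceType) M (f : T -> M) :
  linear (fglift f : {freeg T / R} -> M).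
Proof.
have dM := lift_is_additive f.
pose h : {additive {freeg T / R} -> M} :=
  HB.pack (fglift f) (GRing.isZmodMorphism.Build _ _ _ dM).
have hE (D : {freeg T / R}) : fglift f D = \sum_(x <- dom D) coeff x D *: f x.
  rewrite -[LHS]/(h D) -{1}[D]freeg_sumE raddf_sum.
  by apply: eq_bigr => x _; rewrite /h /= liftU.
move=> a u v; rewrite -[LHS]/(h (a *: u + v)) raddfD; congr (_ + _).
rewrite [in RHS]hE scaler_sumr -[LHS]/(h (fgscale a u)) raddf_sum.
by apply: eq_bigr => x _; rewrite /h /= liftU scalerA.
Qed.

HB.instance Definition _ (T : choiceType) M (f : T -> M) :=
  GRing.isLinear.Build R {freeg T / R} M _ (fglift f) (fglift_linear f).

Lemma freeg_projective (T : choiceType) : projective {freeg T / R}.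
Proof.
move=> M N g f sg.
have /boolp.choice[s sE] : forall x, exists y, g y = f << x >>.
  by move=> x; move/seteqP: sg => [_ /(_ (f << x >>) I)[y _ yE]]; exists y.
exists (fglift s) => D; rewrite -[D]freeg_sumE !linear_sum.
apply: eq_bigr => x _; set c := coeff x D.
have lE : fglift s << c *g x >> = c *: s x by exact: liftU.
transitivity (g (c *: s x)); first by rewrite -lE.
rewrite linearZ sE -linearZ; congr (f _).
have -> // : << c *g x >> = c *: << x >> :> {freeg T / R}.
by apply/eqP/freeg_eqP => y; rewrite coeffZ !coeffU mul1r.
Qed.

(* [P 0] is free on [M], and [P n.+1] is free on the kernel of the previous
   map. *)
Record stage := Stage {
  stage_src : lmodType R; stage_tgt : lmodType R;
  stage_map : {linear stage_src -> stage_tgt} }.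

Definition next_stage (s : stage) : stage :=
  @Stage {freeg (kernel (stage_map s)) / R} (stage_src s)
    (fglift (@kernel_val _ _ _ (stage_map s))).

Definition first_stage M : stage := @Stage {freeg M / R} M (fglift id).

Lemma next_stage_exact (s : stage) :
  range (stage_map (next_stage s)) = [set x | stage_map s x = 0].
Proof.
apply/seteqP; split=> [_ [D _ <-]|x /= x0].
  rewrite /= -[D]freeg_sumE !linear_sum big1 // => k _.
  rewrite [X in stage_map s X](_ : _ = coeff k D *: kernel_val k);
    last exact: liftU.
  have k0 : stage_map s (kernel_val k) = 0 by apply/eqP; exact: (valP k).
  by rewrite linearZ /= k0 scaler0.
have kx : x \in kernel_pred (stage_map s) by apply/eqP.
exists << Kernel kx >> => //=.
by transitivity (1 *: x); [exact: liftU | rewrite scale1r].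
Qed.

Lemma projective_resolution_exists M : inhabited (projective_resolution M).
Proof.
pose st n := iter n next_stage (first_stage M).
have st_proj n : projective (stage_src (st n)).
  by case: n => [|n]; apply: freeg_projective.
split; apply: (@ProjectiveResolution R M (fun n => stage_src (st n))
  (fun n => stage_map (st n.+1)) (stage_map (first_stage M))) => //.
- apply/seteqP; split=> // x _; exists << x >> => //=.
  by transitivity (1 *: x); [exact: liftU | rewrite scale1r].
- exact: (next_stage_exact (first_stage M)).
- by move=> n; exact: (next_stage_exact (st n.+1)).
Qed.

Section Augmented.

Variables (M : lmodType R) (P : projective_resolution M).

Definition aug_mod (n : nat) : lmodType R :=
  if n is m.+1 then P m else M.

Definition aug_diff (n : nat) : {linear aug_mod n.+1 -> aug_mod n} :=
  if n is m.+1 return {linear aug_mod n.+1 -> aug_mod n}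
  then res_diff P m else res_aug P.

Lemma aug_exact n : range (aug_diff n.+1) = [set x | aug_diff n x = 0].
Proof. by case: n => [|n]; [exact: res_exact0 | exact: res_exactS]. Qed.

Lemma aug_diffK n x : aug_diff n (aug_diff n.+1 x) = 0.
Proof. by have /seteqP[+ _] := aug_exact n; apply; exists x. Qed.

End Augmented.

Section ChainMap.

Variables (M : lmodType R) (P Q : projective_resolution M).
Local Notation p := (aug_diff P).
Local Notation q := (aug_diff Q).

Definition chain_square n := {F : {linear aug_mod P n -> aug_mod Q n} *
  {linear aug_mod P n.+1 -> aug_mod Q n.+1} |
  forall x, q n (F.2 x) = F.1 (p n x)}.

Definition chain_square0 : {F : chain_square 0 | (sval F).1 =1 id}.
Proof.
have /boolp.cid[h hE] : exists h : {linear P 0%N -> Q 0%N},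
    res_aug Q \o h =1 res_aug P.
  exact: (@res_projective _ _ P 0%N _ _ (res_aug Q) (res_aug P) (res_aug_surj Q)).
by exists (exist _ (idfun : {linear M -> M}, h) hE).
Qed.

Definition chain_squareS n (F : chain_square n) :
  {G : chain_square n.+1 | (sval G).1 = (sval F).2}.
Proof.
case: F => -[F1 F2] /= FE.
have kF x : q n (F2 (p n.+1 x)) = 0 by rewrite FE aug_diffK linear0.
have [h hE] := projective_lift (f := F2 \o p n.+1)
  (@res_projective _ _ P n.+1) (aug_exact Q n) kF.
by exists (exist _ (F2, h) hE).
Qed.

Lemma chain_map_exists :
  exists F : forall n, {linear aug_mod P n -> aug_mod Q n},
    F 0%N =1 id /\ forall n x, q n (F n.+1 x) = F n (p n x).
Proof.
pose S := fix S n : chain_square n :=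
  if n is m.+1 then sval (chain_squareS (S m)) else sval chain_square0.
exists (fun n => (sval (S n)).1); split; first exact: (svalP chain_square0).
move=> n x; rewrite -(svalP (S n)) /=.
by rewrite (svalP (chain_squareS (S n))).
Qed.

End ChainMap.

Lemma chain_homotopy M (Q : projective_resolution M)
    (E : forall n, {linear aug_mod Q n -> aug_mod Q n}) :
  E 0%N =1 (fun=> 0) ->
  (forall n x, aug_diff Q n (E n.+1 x) = E n (aug_diff Q n x)) ->
  forall n, exists (h : {linear aug_mod Q n -> aug_mod Q n.+1})
                   (h' : {linear aug_mod Q n.+1 -> aug_mod Q n.+2}),
    (n = 0%N -> h =1 (fun=> 0)) /\
    forall x, E n.+1 x = aug_diff Q n.+1 (h' x) + h (aug_diff Q n x).
Proof.
move=> E0 EE.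
have step n (h : {linear aug_mod Q n -> aug_mod Q n.+1}) :
    (forall x, aug_diff Q n (h (aug_diff Q n x)) = E n (aug_diff Q n x)) ->
  exists h' : {linear aug_mod Q n.+1 -> aug_mod Q n.+2},
    forall x, E n.+1 x = aug_diff Q n.+1 (h' x) + h (aug_diff Q n x).
  move=> hE.
  have k0 x : aug_diff Q n ((E n.+1 \- (h \o aug_diff Q n)) x) = 0.
    by rewrite /= linearB EE hE subrr.
  have [h' h'E] := projective_lift (f := E n.+1 \- (h \o aug_diff Q n))
    (@res_projective _ _ Q n) (aug_exact Q n) k0.
  by exists h' => x; rewrite h'E /= subrK.
elim=> [|n [h [h' [_ hE]]]].
  have [|h' h'E] := step 0%N \0; last by exists \0, h'.
  by move=> x; rewrite /= linear0 E0.
have [|h'' h''E] := step n.+1 h'; last by exists h', h''.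
by move=> x; rewrite hE aug_diffK linear0 addr0.
Qed.

Lemma cohomology_neq0_imp M N (P Q : projective_resolution M) n :
  cohomology_neq0 N Q n -> cohomology_neq0 N P n.
Proof.
have [F [F0 FE]] := chain_map_exists P Q.
have [G [G0 GE]] := chain_map_exists Q P.
pose E k : {linear aug_mod Q k -> aug_mod Q k} := (F k \o G k) \- idfun.
have [|k x|h [h' [h0 hE]]] := @chain_homotopy M Q E _ _ n.
- by move=> x; rewrite /E /= F0 G0 subrr.
- by rewrite /E /= linearB FE GE.
move=> [f [fd fnb]]; exists (f \o F n.+1); split=> [x|fFb].
  rewrite /= -[res_diff P n]/(aug_diff P n.+1) -FE; exact: fd.
apply: fnb.
have fE x : f x = f (F n.+1 (G n.+1 x)) - f (h (aug_diff Q n x)).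
  have := congr1 f (hE x); rewrite [RHS]linearD.
  rewrite (fd (h' x) : f (aug_diff Q n.+1 (h' x)) = 0) add0r => <-.
  by rewrite /E /= linearB opprB addrC subrK.
case: n f fd F FE F0 G G0 GE E h h' h0 hE fFb fE =>
  [|n] f fd F FE F0 G G0 GE E h h' h0 hE /=.
  by move=> fFb fE x; rewrite fE fFb h0 // linear0 subr0.
move=> [g gE] fE; exists ((g \o G n.+1) \- (f \o h)) => x.
by rewrite fE gE /= -[res_diff P n]/(aug_diff P n.+1) GE.
Qed.

Lemma Ext_neq0P M N (P : projective_resolution M) n :
  Ext_neq0 n M N <-> cohomology_neq0 N P n.
Proof.
by split=> [[Q]|]; [exact: cohomology_neq0_imp | exists P].
Qed.

End Resolutions.

(* Main.v *)
Require Import Defs.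
From HB Require Import structures.
From mathcomp Require Import all_boot all_order all_algebra all_field.
From mathcomp Require Import boolp classical_sets zify.

(** Why self-extensions propagate.

    Over a Nakayama algebra [A] write [1] as a sum of primitive idempotents
    [e i].  Each [e i * A] and each [A * e i] is uniserial, which is used only
    in elementary form: of two elements of [e i * A] one is a right multiple of
    the other, and dually on the left ([serial_system], [nakayama_serial]).
    The maximal submodule of [e i * A] is then generated by a single [arrow i],
    which ends at a vertex [after i]; products of consecutive arrows are called
    walks, and every nonzero element of [e i * A] is a walk times a generator of
    the projective at its end ([walk_factor]).  So the submodules of [e i * A] are generated by
    the walks from [i], and [walk i s] vanishes exactly when [s] reaches the
    length [colength i] of [e i * A].

    An indecomposable module is cyclic, [M = x A] with annihilator generated by
    a walk of length [l] from a vertex [i0] ([indecomposable_cyclic]).  Place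
    the vertices met from [i0] at positions [0, 1, 2, ...] on a line.  Then [M]
    is the interval from [0] to [l], the cover at position [p] is the interval
    from [p] to [cover_end p], and the syzygies of [M] are the intervals
    between consecutive terms of
    [0, l, cover_end 0, cover_end l, cover_end (cover_end 0), ...] ([syz]).
    This gives an explicit projective resolution whose differentials are left
    multiplications by walks, hence a description of Ext by elements
    ([Ext_neq0_class]).

    A nonzero class in [Ext^1 (M, M)] is a walk from [i0] that overlaps [M].
    The left chain condition turns it into a closed walk of some length [n > 0]
    at [i0], with [n <= l] and [l + n <= cover_end 0] ([self_ext_period]).  The
    whole picture then has period [n].  As [cover_end] is monotone and commutes
    with the shift by [n], a multiple [N * n] exists with
    [syz k < N * n <= syz k.+1 < l + N * n <= syz k.+2] ([shift_between]).
    These inequalities say that the walk from position [N * n] to [syz k.+1] is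
    a nonzero class in degree [k.+1] ([ext_class_shift]). *)

Set Implicit Arguments.
Unset Strict Implicit.
Unset Printing Implicit Defensive.

Import GRing.Theory.

Local Open Scope classical_set_scope.
Local Open Scope ring_scope.

(** * Submodules of uniserial modules *)

(** A length function replaces composition length: strict monotonicity is all
    that refining a chain requires. *)
Definition finite_length (R : nzRingType) (V : lmodType R) : Prop :=
  exists d : set V -> nat, forall S T : set V,
    submodule S -> submodule T -> S `<` T -> (d S < d T)%N.

Section Uniserial.

Variables (R : nzRingType) (V : lmodType R).
Implicit Types S T U : set V.

Local Notation covers := (fun S T : set V => `[< maximal_submodule S T >]).

Lemma saturated_chain S T : finite_length V ->
  submodule S -> submodule T -> S `<=` T ->
  exists2 s, path covers S s & last S s = T.
Proof.
move=> [d d_lt]; have [n] := ubnP (d T - d S)%N.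
elim: n S T => // n IHn S T; rewrite ltnS => len_n subS subT sST.
have [<-|neqST] := pselect (S = T); first by exists [::].
have ltST : S `<` T by rewrite properEneq; split=> //; apply/eqP.
have [[U [subU [ltSU ltUT]]]|noU] :=
    pselect (exists U, submodule U /\ (S `<` U /\ U `<` T)).
  have dSU := d_lt _ _ subS subU ltSU; have dUT := d_lt _ _ subU subT ltUT.
  have [||s1 s1P s1U] := IHn S U _ subS subU; [|by case: ltSU|].
    apply: leq_trans len_n; exact: ltn_sub2r (ltn_trans dSU dUT) dUT.
  have [||s2 s2P s2T] := IHn U T _ subU subT; [|by case: ltUT|].
    apply: leq_trans len_n; exact: ltn_sub2l (ltn_trans dSU dUT) dSU.
  by exists (s1 ++ s2); rewrite ?cat_path ?last_cat s1U ?s1P.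
exists [:: T] => //=; rewrite andbT; apply/asboolP; split=> // U subU sSU sUT.
have [->|neqUS] := pselect (U = S); first by left.
right; apply: contrapT => neqUT; apply: noU; exists U; split=> //.
by split; rewrite properEneq; split=> //; apply/eqP => // eSU; apply: neqUS.
Qed.

Lemma submodule0 : submodule [set 0 : V].
Proof. by split=> // a u v -> ->; rewrite scaler0 addr0. Qed.

Lemma submoduleT : submodule [set: V].
Proof. by []. Qed.

(** Any submodule occurs in some composition series, since the chain from [0]
    through it to the whole module can be refined.  Uniqueness of the series
    then puts all submodules into one chain. *)
Lemma composition_series_through S : finite_length V -> submodule S ->
  exists s i, [/\ composition_series s, nth set0 s i = S, (i < size s)%N &
    sorted (fun S T : set V => `[< S `<=` T >]) s].
Proof.
move=> fl subS.
have [|s1 s1P s1S] := saturated_chain fl submodule0 subS.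
  by move=> x ->; case: subS.
have [//|s2 s2P s2T] := saturated_chain fl subS submoduleT.
have sP : path covers [set 0] (s1 ++ s2) by rewrite cat_path s1P s1S.
exists ([set 0] :: s1 ++ s2), (size s1); split.
- split=> //; first by rewrite /= last_cat s1S.
  by move=> i lt_i; apply/asboolP; exact: (pathP set0 sP).
- by rewrite -cat_cons nth_cat /= ltnSn nth_last.
- by rewrite /= size_cat ltnS leq_addr.
- apply: sub_path sP => S1 S2 /asboolP[_ _ /properW sS12 _]; exact/asboolP.
Qed.

Lemma uniserial_comparable S T : finite_length V -> uniserial V ->
  submodule S -> submodule T -> S `<=` T \/ T `<=` S.
Proof.
move=> fl [s0 [_ s0_uniq]] subS subT.
have [s [i [sC sS lt_i s_sorted]]] := composition_series_through fl subS.
have [t [j [tC tT lt_j _]]] := composition_series_through fl subT.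
have ts : t = s by rewrite -(s0_uniq _ tC) (s0_uniq _ sC).
rewrite {}ts in tT lt_j.
have incl := sorted_leq_nth _ _ set0 s_sorted.
have {}incl (k l : nat) : (k < size s)%N -> (l < size s)%N -> (k <= l)%N ->
    nth set0 s k `<=` nth set0 s l.
  move=> lt_k lt_l le_kl; apply/asboolP; apply: incl le_kl => //.
  by move=> x y z /asboolP yx /asboolP xz; apply/asboolP/(subset_trans yx).
subst S T; case/orP: (leq_total i j) => le_ij; [left|right]; exact: incl.
Qed.

End Uniserial.

(** * Principal projective modules *)

Section PrincipalProjective.

Variable R : nzRingType.

(** [R * e] is the kernel of [x |-> x * e - x].  Over the converse ring it is the
    right ideal [e * A], so a single construction serves both sides. *)
Definition pim_defect (e : R) (x : R^o) : R^o := x * e - x.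

Fact pim_defect_linear (e : R) : linear (pim_defect e).
Proof.
move=> a u v; rewrite /pim_defect scalerBr mulrDl opprD addrACA.
by congr (_ - _ + _); exact/esym/mulrA.
Qed.

HB.instance Definition _ (e : R) :=
  GRing.isLinear.Build R R^o R^o *:%R (pim_defect e) (pim_defect_linear e).

Definition pim (e : R) : lmodType R := kernel (pim_defect e).

Definition pim_val (e : R) (x : pim e) : R := kernel_val x.

Lemma pim_valE e (x : pim e) : pim_val x * e = pim_val x.
Proof. by case: x => x kx; apply/eqP; rewrite -subr_eq0. Qed.

Lemma pim_val_inj e : injective (@pim_val e).
Proof. exact: val_inj. Qed.

Definition pim_elt (e x : R) (xe : x * e = x) : pim e.
Proof. by exists x; rewrite unfold_in /= /pim_defect xe subrr. Defined.

Lemma pim_valP e : linear (@pim_val e : pim e -> R^o).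
Proof. by []. Qed.

Section Hom.

Variables (e : R) (N : lmodType R) (n : N).

(** When [e] is idempotent, every map out of [R * e] has this form
    ([pim_hom_gen]). *)
Definition pim_hom (x : pim e) : N := pim_val x *: n.

Fact pim_hom_linear : linear pim_hom.
Proof. by move=> a u v; rewrite /pim_hom pim_valP scalerDl scalerA. Qed.

HB.instance Definition _ := GRing.isLinear.Build R (pim e) N *:%R pim_hom
  pim_hom_linear.

End Hom.

Variable e : R.
Hypothesis ee : e * e = e.

Definition pim_gen : pim e := pim_elt ee.

Lemma pim_genE (x : pim e) : x = pim_val x *: pim_gen.
Proof. by apply: pim_val_inj; rewrite -[LHS]pim_valE. Qed.

Lemma pim_hom_gen (N : lmodType R) (f : {linear pim e -> N}) x :
  f x = pim_val x *: f pim_gen.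
Proof. by rewrite {1}(pim_genE x) linearZ. Qed.

Lemma pim_finitely_generated : finitely_generated (pim e).
Proof.
exists [:: pim_gen] => x; exists (fun=> pim_val x).
by rewrite big_ord_recl big_ord0 addr0 {1}(pim_genE x).
Qed.

Lemma pim_projective : projective (pim e).
Proof.
move=> M N g f /seteqP[_ /(_ (f pim_gen) I)[m _ gm]].
exists (@pim_hom e M m) => x.
by rewrite /= /pim_hom linearZ gm [RHS]pim_hom_gen.
Qed.

(** A decomposition splits the generator as [e = u + v]; then [u] is an
    idempotent of [e * R * e], so primitivity makes it [0] or [e]. *)
Lemma pim_indecomposable : e != 0 ->
  (forall g, g * g = g -> e * g = g -> g * e = g -> g = 0 \/ g = e) ->
  indecomposable (pim e).
Proof.
move=> e0 e_prim; split.
  by exists pim_gen => /(congr1 (@pim_val e))/eqP; rewrite (negPf e0).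
move=> S T subS subT ST0 STT.
have : [set u + v | u in S & v in T] pim_gen by rewrite STT.
move=> [u Su [v Tv uvE]].
have eE : e = pim_val u + pim_val v by rewrite -[LHS]/(pim_val pim_gen) -uvE.
have scal (W : set (pim e)) a w : submodule W -> W w -> W (a *: w).
  by move=> [W0 Wlin] Ww; rewrite -[_ *: _]addr0; apply: Wlin.
have kill w : S w -> T w -> w = 0.
  by move=> Sw Tw; have : (S `&` T) w by []; rewrite ST0.
have uE : u = pim_val u *: u + pim_val u *: v.
  by rewrite -scalerDr uvE -pim_genE.
have vE : v = pim_val v *: u + pim_val v *: v.
  by rewrite -scalerDr uvE -pim_genE.
have uv0 : pim_val u *: v = 0.
  apply: kill; last exact: scal.
  rewrite (_ : _ *: v = (- pim_val u) *: u + u); last first.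
    by rewrite [X in _ = _ + X]uE scaleNr addKr.
  by case: subS => _; apply.
have vu0 : pim_val v *: u = 0.
  apply: kill; first exact: scal.
  rewrite (_ : _ *: u = (- pim_val v) *: v + v); last first.
    by rewrite [X in _ = _ + X]vE scaleNr [X in _ + X]addrC addKr.
  by case: subT => _; apply.
have uu : pim_val u * pim_val u = pim_val u.
  by rewrite [in RHS]uE uv0 addr0.
have vu : pim_val v * pim_val u = 0 by rewrite -[LHS]/(pim_val (_ *: u)) vu0.
have eu : e * pim_val u = pim_val u by rewrite {1}eE mulrDl vu addr0.
have full (W W' : set (pim e)) : submodule W -> W pim_gen ->
    W `&` W' = [set 0] -> submodule W' -> W' = [set 0].
  move=> subW Wg WW' [W'0 _]; apply/seteqP; split=> [w W'w|_ ->//].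
  by rewrite -WW'; split=> //; rewrite (pim_genE w); apply: scal.
have [u0|u_e] := e_prim _ uu eu (pim_valE u).
  left; apply: (full T) => //; last by rewrite setIC.
  by rewrite -uvE (pim_val_inj (u0 : pim_val u = pim_val 0)) add0r.
right; apply: (full S) => //.
by rewrite -(pim_val_inj (u_e : pim_val u = pim_val pim_gen)).
Qed.

Lemma uniserial_pim_chain : finite_length R^o -> uniserial (pim e) ->
  forall x y, x * e = x -> y * e = y ->
  (exists r, x = r * y) \/ (exists r, y = r * x).
Proof.
move=> [d d_lt] uni x y xe ye.
pose im (S : set (pim e)) : set R^o := [set pim_val s | s in S].
have im_sub S : submodule S -> submodule (im S).
  move=> [S0 Slin]; split; first by exists 0.
  by move=> a _ _ [u Su <-] [v Sv <-]; exists (a *: u + v) => //; exact: Slin.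
have fl : finite_length (pim e).
  exists (d \o im) => S T subS subT ST; apply: d_lt; try exact: im_sub.
  case: ST => ST TS; split; first exact: image_subset.
  by move=> imTS; apply: TS => t Tt; have [|s Ss /pim_val_inj<-] :=
    imTS (pim_val t); first by exists t.
pose cyc z : set (pim e) := [set s | exists r, pim_val s = r * z].
have cyc_sub z : submodule (cyc z).
  split; first by exists 0; rewrite mul0r.
  move=> a u v [r rE] [r' r'E]; exists (a * r + r').
  by rewrite pim_valP rE r'E mulrDl -mulrA.
have [xy|yx] := uniserial_comparable fl uni (cyc_sub x) (cyc_sub y).
- by left; apply: (xy (pim_elt xe)); exists 1; rewrite mul1r.
- by right; apply: (yx (pim_elt ye)); exists 1; rewrite mul1r.
Qed.

End PrincipalProjective.

(** * Primitive idempotents of a Nakayama algebra *)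

Lemma vector_finite_length (K : fieldType) (W : vectType K) :
  finite_length (W : lmodType K).
Proof.
have spaceP (S : set W) : submodule S ->
    exists U : {vspace W}, forall x, S x <-> x \in U.
  move=> [S0 Slin].
  pose P n := `[< exists U : {vspace W}, \dim U = n /\ {in U, forall x, S x} >].
  have exP : exists n, P n.
    exists 0%N; apply/asboolP; exists 0%VS; rewrite dimv0; split=> // x.
    by rewrite memv0 => /eqP->.
  have boundP n : P n -> (n <= dim W)%N.
    by move=> /asboolP[U [<- _]]; rewrite -dimvf; exact/dimvS/subvf.
  case: (ex_maxnP exP boundP) => n /asboolP[U [dU US]] maxn.
  exists U => x; split=> [Sx|]; last exact: US.
  have Ux : P (\dim (U + <[x]>)).
    apply/asboolP; exists (U + <[x]>)%VS; split=> // y.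
    move=> /memv_addP[u Uu [_ /vlineP[k ->] ->]].
    by rewrite addrC; apply: Slin => //; apply: US.
  have := maxn _ Ux; rewrite -dU => le_dim.
  have /eqP-> : U == (U + <[x]>)%VS by rewrite eqEdim addvSl.
  by rewrite (subvP (addvSr _ _)) ?memv_line.
pose sp (S : set W) : {vspace W} :=
  xget 0%VS [set U : {vspace W} | forall x, S x <-> x \in U].
have spE S : submodule S -> forall x, S x <-> x \in sp S.
  by move=> subS; exact: (@xgetPex _ 0%VS [set U : {vspace W} | _] (spaceP S subS)).
exists (fun S => \dim (sp S)) => S T subS subT [ST TS].
rewrite ltn_neqAle dimvS ?andbT; last first.
  by apply/subvP => x /(spE S subS) Sx; apply/(spE T subT)/ST.
apply/eqP => eq_dim; apply: TS => x /(spE T subT) Tx; apply/(spE S subS).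
suff /eqP-> : sp S == sp T by [].
rewrite eqEdim eq_dim leqnn andbT.
by apply/subvP => y /(spE S subS) Sy; apply/(spE T subT)/ST.
Qed.

Section FiniteDimensional.

Variables (K : fieldType) (A : falgType K).

Lemma left_finite_length : finite_length A^o.
Proof.
have [d d_lt] := vector_finite_length A; exists d => S T [S0 Slin] [T0 Tlin].
by apply: d_lt; split=> // k u v; rewrite -mulr_algl; [exact: Slin|exact: Tlin].
Qed.

Lemma right_finite_length : finite_length (A^c)^o.
Proof.
have [d d_lt] := vector_finite_length A; exists d => S T [S0 Slin] [T0 Tlin].
by apply: d_lt; split=> // k u v; rewrite -mulr_algr; [exact: Slin|exact: Tlin].
Qed.

End FiniteDimensional.

Definition primitive_idempotent (R : nzRingType) (e : R) : Prop :=
  [/\ e != 0, e * e = e &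
      forall g, g * g = g -> e * g = g -> g * e = g -> g = 0 \/ g = e].

(** Split [e] as [g + (e - g)] as long as possible: the dimension of the left
    ideal generated by the idempotent drops in each of the two parts. *)
Lemma primitive_decomposition (K : fieldType) (A : falgType K) (e : A) :
  e * e = e ->
  exists2 s : seq A, {in s, forall x, primitive_idempotent x} &
    e = \sum_(x <- s) x.
Proof.
pose rk (x : A) := \dim (limg (amulr x)).
have rk_lt (f g : A) : f * f = f -> f * g = f -> g * f <> g -> (rk f < rk g)%N.
  move=> ff fg gf.
  have sfg : (limg (amulr f) <= limg (amulr g))%VS.
    apply/subvP => _ /memv_imgP[x _ ->]; rewrite lfunE /= -fg mulrA.
    by apply/memv_imgP; exists (x * f); rewrite ?memvf ?lfunE.
  rewrite /rk ltn_neqAle dimvS // andbT; apply/eqP => eq_dim; apply: gf.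
  have /eqP eq_im : limg (amulr f) == limg (amulr g).
    by rewrite eqEdim sfg eq_dim /=.
  have /memv_imgP[x _ ->] : g \in limg (amulr f).
    rewrite eq_im; apply/memv_imgP; exists 1; rewrite ?memvf //.
    by rewrite lfunE /= mul1r.
  by rewrite lfunE /= -mulrA ff.
have [n] := ubnP (rk e); elim: n e => // n IHn e; rewrite ltnS => le_n ee.
have [e_prim|] := pselect (primitive_idempotent e).
  by exists [:: e]; [move=> x; rewrite inE => /eqP->|rewrite big_seq1].
have [->|e0 not_prim] := eqVneq e 0; first by exists [::]; rewrite ?big_nil.
have [g [gg eg ge g0 gne]] : exists g,
    [/\ g * g = g, e * g = g, g * e = g, g <> 0 & g <> e].
  apply: contrapT => noG; apply: not_prim; split=> // g gg eg ge.
  by apply: contrapT => /not_orP[g0 gne]; apply: noG; exists g.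
have hh : (e - g) * (e - g) = e - g.
  by rewrite mulrBl !mulrBr ee eg ge gg subrr subr0.
have he : (e - g) * e = e - g by rewrite mulrBl ee ge.
have eh : e * (e - g) = e - g by rewrite mulrBr ee eg.
have [|s sP sE] := IHn g _ gg.
  by apply: leq_trans le_n; apply: rk_lt; rewrite ?eg // => /esym.
have [|t tP tE] := IHn (e - g) _ hh.
  apply: leq_trans le_n; apply: rk_lt; rewrite ?eh // => /eqP.
  by rewrite subr_eq addrC -subr_eq subrr eq_sym => /eqP.
exists (s ++ t); last by rewrite big_cat /= -sE -tE [RHS]addrC subrK.
by move=> x; rewrite mem_cat => /orP[/sP|/tP].
Qed.

(** The trace of the Nakayama condition on elements: everything below uses only
    these five properties.
    The last one bounds chains of principal right ideals. *)
Record serial_system (A : nzRingType) (I : finType) (e : I -> A) : Prop :=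
  SerialSystem {
    ser_prim : forall i, primitive_idempotent (e i);
    ser_sum : \sum_i e i = 1;
    ser_right : forall i x y, e i * x = x -> e i * y = y ->
      (exists r, x = y * r) \/ (exists r, y = x * r);
    ser_left : forall i x y, x * e i = x -> y * e i = y ->
      (exists r, x = r * y) \/ (exists r, y = r * x);
    ser_length : exists d : A -> nat, forall x y,
      (exists r, x = y * r) -> (~ exists r, y = x * r) -> (d x < d y)%N
  }.

Lemma nakayama_serial (K : fieldType) (A : falgType K) : nakayama A ->
  exists (m : nat) (e : 'I_m -> A), serial_system e.
Proof.
move=> [nakL nakR].
have [s sP sE] := @primitive_decomposition K A 1 (mulr1 1).
have prim (i : 'I_(size s)) : primitive_idempotent (s`_i) by apply/sP/mem_nth.
exists (size s), (fun i => s`_i); split=> //.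
- by rewrite sE (big_nth 0) big_mkord.
- move=> i x y ex ey; have [e0 ee min_e] := prim i.
  have uni : uniserial (@pim A^c s`_i).
    apply: nakR; [exact: pim_finitely_generated|exact: pim_projective|].
    by apply: pim_indecomposable => // g gg eg ge; apply: min_e.
  exact: (@uniserial_pim_chain A^c s`_i (right_finite_length A) uni x y).
- move=> i x y ex ey; have [e0 ee min_e] := prim i.
  apply: (@uniserial_pim_chain A s`_i (left_finite_length A)) => //.
  apply: nakL; [exact: pim_finitely_generated|exact: pim_projective|].
  exact: pim_indecomposable.
- exists (fun x => \dim (limg (amull x))) => x y [r ->] ny.
  rewrite ltn_neqAle dimvS ?andbT; last first.
    apply/subvP => _ /memv_imgP[z _ ->]; rewrite lfunE /= -mulrA.
    by apply/memv_imgP; exists (r * z); rewrite ?memvf ?lfunE.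
  apply/eqP => eq_dim; apply: ny.
  have /eqP eq_im : limg (amull (y * r)) == limg (amull y).
    rewrite eqEdim eq_dim leqnn andbT.
    apply/subvP => _ /memv_imgP[z _ ->]; rewrite lfunE /= -mulrA.
    by apply/memv_imgP; exists (r * z); rewrite ?memvf ?lfunE.
  have /memv_imgP[z _ yE] : y \in limg (amull (y * r)).
    by rewrite eq_im; apply/memv_imgP; exists 1; rewrite ?memvf ?lfunE /= ?mulr1.
  by exists z; rewrite {1}yE lfunE.
Qed.

(** * Walks in a serial system *)

Section Walks.

Variables (A : nzRingType) (I : finType) (e : I -> A).
Hypothesis sys : serial_system e.

Lemma ser_idem i : e i * e i = e i.
Proof. by have [] := ser_prim sys i. Qed.

Lemma ser_neq0 i : e i != 0.
Proof. by have [] := ser_prim sys i. Qed.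

Definition rideal (y x : A) : Prop := exists r, x = y * r.

Lemma ridealM y x r : rideal y x -> rideal y (x * r).
Proof. by move=> [s ->]; exists (s * r); rewrite mulrA. Qed.

Lemma rideal_trans z y x : rideal z y -> rideal y x -> rideal z x.
Proof. by move=> [s ->] [r ->]; exists (s * r); rewrite mulrA. Qed.

Lemma rideal_id y : rideal y y.
Proof. by exists 1; rewrite mulr1. Qed.

Definition generates i (x : A) : Prop := exists v, x * v = e i.

(** If [x * v = e i] then [v * x] is, after cutting [v] down, a nonzero
    idempotent of [e j * A * e j], hence equal to [e j] by primitivity.  A
    surjection between indecomposable projectives is thus an isomorphism, which
    makes the notion of generator symmetric in left and right. *)
Lemma generates_inv i j x : e i * x = x -> x * e j = x -> generates i x ->
  exists v, [/\ e j * v = v, v * e i = v, x * v = e i & v * x = e j].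
Proof.
move=> ex xe [v xv]; pose w := e j * v * e i.
have ew : e j * w = w by rewrite /w !mulrA ser_idem.
have we : w * e i = w by rewrite /w -mulrA ser_idem.
have xw : x * w = e i by rewrite /w !mulrA xe xv ser_idem.
exists w; split=> //; have [_ _ min_e] := ser_prim sys j.
have [|||wx0|//] := min_e (w * x).
- by rewrite mulrA -(mulrA w) xw we.
- by rewrite mulrA ew.
- by rewrite -mulrA xe.
have : e i * e i = 0 by rewrite -xw -mulrA (mulrA w) wx0 mul0r mulr0.
by rewrite ser_idem => e0; have := ser_neq0 i; rewrite e0 eqxx.
Qed.

Lemma generatesM i j x y : x * e j = x ->
  generates i x -> generates j y -> generates i (x * y).
Proof.
move=> xe [v xv] [w yw]; exists (w * v).
by rewrite mulrA -(mulrA x) yw xe.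
Qed.

(** The maximal submodule of [e i * A]. *)
Definition in_rad i (x : A) : Prop := e i * x = x /\ ~ generates i x.

Lemma in_radD i x y : in_rad i x -> in_rad i y -> in_rad i (x + y).
Proof.
move=> [ex gx] [ey gy]; split; first by rewrite mulrDr ex ey.
have [[r xE]|[r yE]] := ser_right sys ex ey.
- move=> [v vE]; apply: gy; exists ((r + 1) * v).
  by rewrite mulrA mulrDr mulr1 -xE.
- move=> [v vE]; apply: gx; exists ((1 + r) * v).
  by rewrite mulrA mulrDr mulr1 -yE.
Qed.

Lemma in_radMr i x r : in_rad i x -> in_rad i (x * r).
Proof.
move=> [ex gx]; split; first by rewrite mulrA ex.
by move=> [v vE]; apply: gx; exists (r * v); rewrite mulrA.
Qed.

(** Left multiplication cannot turn a non-generator into a generator: if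
    [t * x] generates, so does [t], which is then invertible, and conjugating
    by [t] shows that [x] generates as well. *)
Lemma in_radMl i j t x : e j * t = t -> in_rad i x -> in_rad j (t * x).
Proof.
move=> et [ex gx]; split; first by rewrite mulrA et.
move=> [v vE]; apply: gx.
have txE : t * e i * (x * v) = e j by rewrite -mulrA (mulrA (e i)) ex mulrA.
have [|||w [ew we tw wt]] := @generates_inv j i (t * e i).
- by rewrite mulrA et.
- by rewrite -mulrA ser_idem.
- by exists (x * v).
exists (v * (t * e i)).
have -> : x * (v * (t * e i)) = e i * (x * v) * (t * e i).
  by rewrite [e i * _]mulrA ex mulrA.
by rewrite -{1}wt -(mulrA w) txE we wt.
Qed.

(** Isomorphism of [e i * A] and [e j * A]. *)
Definition isoc i j : Prop :=
  exists u, [/\ e i * u = u, u * e j = u & generates i u].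

Lemma isoc_refl i : isoc i i.
Proof. by exists (e i); split; rewrite ?ser_idem //; exists (e i); rewrite ser_idem. Qed.

Lemma isoc_sym i j : isoc i j -> isoc j i.
Proof.
move=> [u [eu ue gu]]; have [v [ev ve uv vu]] := generates_inv eu ue gu.
by exists v; split=> //; exists u.
Qed.

Lemma isoc_trans i j k : isoc i j -> isoc j k -> isoc i k.
Proof.
move=> [u [eu ue gu]] [v [ev ve gv]]; exists (u * v).
by split; [rewrite mulrA eu|rewrite -mulrA ve|exact: generatesM gv].
Qed.

Definition rep i : I := odflt i [pick j | `[< isoc i j >]].

Lemma isoc_rep i : isoc i (rep i).
Proof. by rewrite /rep; case: pickP => [j /asboolP //|_]; exact: isoc_refl. Qed.

Lemma rep_isoc i j : isoc i j -> rep i = rep j.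
Proof.
move=> ij; rewrite /rep (@eq_pick _ _ (fun k => `[< isoc j k >])); last first.
  move=> k; apply/asbool_equiv_eq; split=> ik; last exact: isoc_trans ik.
  exact: isoc_trans (isoc_sym ij) ik.
by case: pickP => // /(_ j); rewrite asboolT //; exact: isoc_refl.
Qed.

Lemma rep_inj i j : rep i = i -> rep j = j -> isoc i j -> i = j.
Proof. by move=> ri rj /rep_isoc; rewrite ri rj. Qed.

(** The maximal submodule of [e i * A] is generated by any of its elements
    [x * e j] spanning a right ideal of largest length.  Passing from [j] to
    the representative of its class makes the end vertex of the arrow
    canonical, so that isomorphic vertices on a walk are equal. *)
Lemma rad_principal i : exists p : I * A,
  [/\ rep p.1 = p.1, p.2 * e p.1 = p.2, in_rad i p.2 &
      forall x, in_rad i x -> rideal p.2 x].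
Proof.
have [d d_lt] := ser_length sys.
pose Q n := `[< exists j x, [/\ x * e j = x, in_rad i x & d x = n] >].
have rad0 : in_rad i 0.
  split; first by rewrite mulr0.
  by move=> [v]; rewrite mul0r => e0; have := ser_neq0 i; rewrite -e0 eqxx.
have exQ : exists n, Q n.
  by exists (d 0); apply/asboolP; exists i, 0; rewrite mul0r.
have boundQ n : Q n -> (n <= d (e i))%N.
  move=> /asboolP[j [x [_ [ex gx] <-]]]; apply/ltnW/d_lt; first by exists x.
  by move=> [v vE]; apply: gx; exists v.
case: (ex_maxnP exQ boundQ) => n /asboolP[j [x [xe radx dx]]] max_n.
have x_max y : in_rad i y -> rideal x y.
  move=> rady; rewrite -[y]mulr1 -(ser_sum sys) mulr_sumr.
  apply: (big_ind (rideal x)) => [|y1 y2 [r1 ->] [r2 ->]|k _].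
  - by exists 0; rewrite mulr0.
  - by exists (r1 + r2); rewrite mulrDr.
  have radyk : in_rad i (y * e k) by exact: in_radMr.
  have [//|xyk] := ser_right sys radyk.1 radx.1.
  apply: contrapT => nyk; have := d_lt _ _ xyk nyk; rewrite dx ltnNge max_n //.
  by apply/asboolP; exists k, (y * e k); split=> //; rewrite -mulrA ser_idem.
have [u [eu ue gu]] := isoc_rep j; have [v [ev ve uv vu]] := generates_inv eu ue gu.
exists (rep j, x * u); split=> [|||y rady] /=.
- exact/esym/rep_isoc/isoc_rep.
- by rewrite -mulrA ue.
- exact: in_radMr.
by have [r ->] := x_max y rady; exists (v * r); rewrite mulrA -(mulrA x) uv xe.
Qed.

(** [after i] is the vertex of the projective cover of the radical of
    [e i * A]. *)
Definition after i : I := (sval (boolp.cid (rad_principal i))).1.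
Definition arrow i : A := (sval (boolp.cid (rad_principal i))).2.

Lemma rep_after i : rep (after i) = after i.
Proof. by rewrite /after; case: boolp.cid => p []. Qed.

Lemma arrow_after i : arrow i * e (after i) = arrow i.
Proof. by rewrite /after /arrow; case: boolp.cid => p []. Qed.

Lemma in_rad_arrow i : in_rad i (arrow i).
Proof. by rewrite /arrow; case: boolp.cid => p []. Qed.

Lemma in_rad_rideal i x : in_rad i x -> rideal (arrow i) x.
Proof. by rewrite /arrow; case: boolp.cid => p [_ _ _ +] /= => /[apply]. Qed.

Fixpoint walk i s : A := if s is s'.+1 then arrow i * walk (after i) s' else e i.

Definition target i s : I := iter s after i.

Lemma targetD i s t : target (target i s) t = target i (s + t).
Proof. by rewrite /target addnC iterD. Qed.

Lemma walk_source i s : e i * walk i s = walk i s.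
Proof. by case: s => [|s] /=; rewrite ?ser_idem // mulrA (in_rad_arrow i).1. Qed.

Lemma walk_target i s : walk i s * e (target i s) = walk i s.
Proof.
elim: s i => [|s IHs] i /=; first exact: ser_idem.
by rewrite /target -iterS iterSr -mulrA [X in _ * X]IHs.
Qed.

Lemma walkD i s t : walk i (s + t) = walk i s * walk (target i s) t.
Proof.
elim: s i => [|s IHs] i /=; first by rewrite walk_source.
by rewrite -mulrA IHs {2}/target -iterS iterSr.
Qed.

Lemma walk1 i : walk i 1 = arrow i.
Proof. exact: arrow_after. Qed.

Lemma rideal_walkD i s t : rideal (walk i s) (walk i (s + t)).
Proof. by rewrite walkD; exact/ridealM/rideal_id. Qed.

Lemma rideal_walk i s t : (s <= t)%N -> rideal (walk i s) (walk i t).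
Proof. by move=> /subnKC<-; exact: rideal_walkD. Qed.

(** Walks of length [s] generate the [s]-th power of the radical, which is a
    two-sided ideal; this is the form in which that fact is used. *)
Lemma walk_mull i j t s : e i * t = t -> rideal (walk i s) (t * walk j s).
Proof.
move=> et; elim: s => [|s [r rE]].
  by exists (t * e j); rewrite mulrA et.
have -> : t * walk j s.+1 =
    walk i s * (e (target i s) * r * arrow (target j s)).
  by rewrite -addn1 walkD walk1 mulrA rE !mulrA walk_target.
have [|r' ->] := @in_rad_rideal (target i s)
    (e (target i s) * r * arrow (target j s)).
  by apply: in_radMl (in_rad_arrow _); rewrite mulrA ser_idem.
by exists r'; rewrite -addn1 walkD walk1 mulrA.
Qed.

Lemma walk_in_radl i j t s : in_rad i t ->
  rideal (walk i s.+1) (t * walk j s).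
Proof.
move=> /in_rad_rideal[r ->].
have [|r' r'E] := @walk_mull (after i) j (e (after i) * r) s.
  by rewrite mulrA ser_idem.
by exists r'; rewrite /= -[RHS]mulrA -r'E !mulrA arrow_after.
Qed.

Lemma in_rad_idem i : ~ in_rad i (e i).
Proof. by move=> [_]; apply; exists (e i); rewrite ser_idem. Qed.

(** Nakayama's lemma: [w = w * z] with [z] in the radical of a local ring forces
    [w = 0]. *)
Lemma walk_strict i s : walk i s <> 0 -> ~ rideal (walk i s.+1) (walk i s).
Proof.
move=> w0 [r]; rewrite -addn1 walkD walk1; set j := target i s => wE; apply: w0.
pose z := arrow j * r * e j.
have radz : in_rad j z by do 2!apply: in_radMr; exact: in_rad_arrow.
have wz : walk i s * (e j - z) = 0.
  by rewrite mulrBr walk_target /z !mulrA -wE walk_target subrr.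
have [[v vE]|nv] := pselect (generates j (e j - z)).
  by rewrite -[LHS]walk_target -/j -vE mulrA wz mul0r.
case: (@in_rad_idem j); rewrite -[e j](subrK z); apply: in_radD => //.
by split=> //; rewrite mulrBr ser_idem radz.1.
Qed.

Lemma walk_leq i s t : walk i s <> 0 -> rideal (walk i t) (walk i s) -> (t <= s)%N.
Proof.
move=> w0 st; rewrite leqNgt; apply/negP => lt_st; apply: walk_strict w0 _.
exact: rideal_trans (rideal_walk i lt_st) st.
Qed.

Lemma walk_nilpotent : exists T, forall i, walk i T = 0.
Proof.
have [d d_lt] := ser_length sys; exists (\max_i d (e i)).+1 => i.
apply: contrapT => w0.
suff bound s : walk i s <> 0 -> (s + d (walk i s) <= d (e i))%N.
  have := leq_trans (leq_addr _ _) (bound _ w0).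
  by rewrite ltnNge (leq_bigmax (F := fun i => d (e i))).
elim: s => [//|s IHs] ws1.
have ws : walk i s <> 0.
  by move=> ws; apply: ws1; rewrite -addn1 walkD ws mul0r.
apply: leq_trans (IHs ws); rewrite addSnnS leq_add2l; apply: d_lt.
  exact: rideal_walk (leqnSn s).
exact: walk_strict.
Qed.

(** Take for [walk i s] the longest walk of which [y] is a right multiple: the
    cofactor is not in the radical, so it generates.  The idempotent [z] records
    an end of [y]; take [z = 1] if there is none. *)
Lemma walk_factor i z y : z * z = z -> e i * y = y -> y * z = y -> y <> 0 ->
  exists s u, [/\ y = walk i s * u, e (target i s) * u = u, u * z = u &
                  generates (target i s) u].
Proof.
move=> zz ey yz y0; have [T wT] := walk_nilpotent.
pose Q s := `[< rideal (walk i s) y >].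
have exQ : exists s, Q s by exists 0%N; apply/asboolP; exists y.
have boundQ s : Q s -> (s <= T)%N.
  move=> /asboolP Qs; rewrite leqNgt; apply/negP => /ltnW/(rideal_walk i) Ts.
  by apply: y0; have [r ->] := rideal_trans Ts Qs; rewrite wT mul0r.
case: (ex_maxnP exQ boundQ) => s /asboolP[r rE] max_s.
set j := target i s; pose u := e j * r * z.
have eu : e j * u = u by rewrite /u !mulrA ser_idem.
have yE : y = walk i s * u by rewrite /u !mulrA walk_target -rE yz.
exists s, u; split=> //; first by rewrite /u -mulrA zz.
apply: contrapT => ng.
have [|r' r'E] := @in_rad_rideal j u; first by split.
have /max_s : Q s.+1; last by rewrite ltnn.
by apply/asboolP; exists r'; rewrite yE r'E -addn1 walkD walk1 mulrA.
Qed.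

Fact walk_eventually0 i : exists s, walk i s == 0.
Proof. by have [T wT] := walk_nilpotent; exists T; rewrite wT. Qed.

(** The length of [e i * A], found as the length of the shortest zero walk. *)
Definition colength i : nat := ex_minn (walk_eventually0 i).

Lemma walk_eq0 i s : (walk i s == 0) = (colength i <= s)%N.
Proof.
rewrite /colength; case: ex_minnP => c /eqP wc min_c.
apply/idP/idP => [/min_c //|/(rideal_walk i)[r ->]].
by rewrite wc mul0r.
Qed.

Lemma walk_colength i : walk i (colength i) = 0.
Proof. by apply/eqP; rewrite walk_eq0. Qed.

Lemma walk_neq0 i s : (s < colength i)%N -> walk i s <> 0.
Proof. by move=> lt_s /eqP; rewrite walk_eq0 leqNgt lt_s. Qed.

(** The cover of the radical of [e i * A] is at least as long as the radical. *)
Lemma colength_after i : (colength i <= (colength (after i)).+1)%N.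
Proof. by rewrite -walk_eq0 /= walk_colength mulr0. Qed.

(** Left multiplication by a walk, from the projective at its end, has as kernel
    the right ideal of the walk that completes it to the shortest zero walk. *)
Lemma walk_annihilator i s y : (s <= colength i)%N -> e (target i s) * y = y ->
  walk i s * y = 0 -> rideal (walk (target i s) (colength i - s)) y.
Proof.
move=> le_s ey wy0; have [->|y0] := eqVneq y 0.
  by exists 0; rewrite mulr0.
have [t [u [yE eu _ [v uv]]]] :=
  walk_factor (mulr1 1) ey (mulr1 y) (elimN eqP y0).
rewrite yE; apply/ridealM/rideal_walk; rewrite leq_subLR -walk_eq0 walkD.
apply/eqP; rewrite -[X in _ * X]walk_target -uv [X in _ * X]mulrA -yE.
by rewrite mulrA wy0 mul0r.
Qed.

(** An isomorphism of tops moves across a nonzero walk, since walks generate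
    two-sided powers of the radical and the walk is outside the next power. *)
Lemma generates_walk i j u s : e i * u = u -> u * e j = u -> generates i u ->
  walk i s <> 0 ->
  exists u', [/\ e (target i s) * u' = u', u' * e (target j s) = u',
    generates (target i s) u' & u * walk j s = walk i s * u'].
Proof.
move=> eu ue gu ws; have [v [ev ve uv vu]] := generates_inv eu ue gu.
have [r rE] := walk_mull j s eu; have [r' r'E] := walk_mull i s ev.
set i' := target i s; set j' := target j s in r'E *.
pose u' := e i' * r * e j'.
have u'E : u * walk j s = walk i s * u'.
  by rewrite /u' !mulrA walk_target -rE -mulrA walk_target.
have eu' : e i' * u' = u' by rewrite /u' !mulrA ser_idem.
exists u'; split=> //; first by rewrite /u' -mulrA ser_idem.
apply: contrapT => ngu'; apply: (walk_strict ws).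
have [|r'' r''E] := @in_rad_rideal i' u'; first by split.
have -> : walk i s = u * (v * walk i s) by rewrite mulrA uv walk_source.
rewrite r'E mulrA u'E r''E; exists (r'' * r').
by rewrite -addn1 walkD walk1 !mulrA.
Qed.

End Walks.

(** * Indecomposable modules are cyclic *)

Section RightModules.

Variables (A : nzRingType) (M : lmodType A^c).
Implicit Types (x y : M) (a b : A).

(** Right action: scaling over the converse ring, with the arguments in the
    usual order. *)
Definition ract x a : M := (a : A^c) *: x.

Lemma ractA x a b : ract (ract x a) b = ract x (a * b).
Proof. exact: scalerA. Qed.

Lemma ract1 x : ract x 1 = x.
Proof. exact: scale1r. Qed.

Lemma ractDl x y a : ract (x + y) a = ract x a + ract y a.
Proof. exact: scalerDr. Qed.

Lemma ractDr x a b : ract x (a + b) = ract x a + ract x b.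
Proof. exact: scalerDl. Qed.

Lemma ractNl x a : ract (- x) a = - ract x a.
Proof. exact: scalerN. Qed.

Lemma ract0l a : ract 0 a = 0.
Proof. exact: scaler0. Qed.

Lemma ract0r x : ract x 0 = 0.
Proof. exact: scale0r. Qed.

End RightModules.

Section IndecomposableModules.

Variables (A : nzRingType) (I : finType) (e : I -> A).
Hypothesis sys : serial_system e.
Variable M : lmodType A^c.
Implicit Types (x y : M) (a b : A).

Local Notation walk := (walk sys).
Local Notation target := (target sys).
Local Notation arrow := (arrow sys).

Lemma ract_sum_idem x : x = \sum_i ract x (e i).
Proof.
rewrite -[LHS]ract1 -(ser_sum sys) /ract scaler_suml.
by [].
Qed.

(** Let [t.+1] be the Loewy length of the module.  Some [x] at a vertex is not
    killed by the [t]-th power of the radical; such an [x] generates a uniserial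
    submodule of largest length. *)
Lemma longest_orbit : (exists x : M, x <> 0) ->
  exists i (x : M) t, [/\ ract x (e i) = x, ract x (walk i t) <> 0 &
    forall y j, ract y (walk j t.+1) = 0].
Proof.
move=> [z z0]; have [T wT] := walk_nilpotent sys.
pose Q t := `[< forall (y : M) j, ract y (walk j t) = 0 >].
have exQ : exists t, Q t.
  by exists T; apply/asboolP => y j; rewrite wT ract0r.
case: (ex_minnP exQ) => -[|t] /asboolP Qt min_t.
  by case: z0; rewrite [z]ract_sum_idem big1 // => i _; exact: (Qt z i).
have [y [i yi]] : exists (y : M) i, ract y (walk i t) <> 0.
  apply: contrapT => noy; suff /min_t : Q t by rewrite ltnn.
  by apply/asboolP => y i; apply: contrapT => yi; apply: noy; exists y, i.
exists i, (ract y (e i)), t; split=> //; first by rewrite ractA (ser_idem sys).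
by rewrite ractA walk_source.
Qed.

(** Zorn's lemma for submodules meeting [S] trivially.  The sets considered may
    be empty, because an empty chain has empty union. *)
Lemma orbit_complement (S : set M) : submodule S ->
  exists C : set M, [/\ submodule C, forall z, C z -> S z -> z = 0 &
    forall B : set M, submodule B -> C `<` B -> exists z, [/\ B z, S z & z <> 0]].
Proof.
move=> subS.
pose P (C : set M) := (forall (a : A^c) u v, C u -> C v -> C (a *: u + v)) /\
  forall z, C z -> S z -> z = 0.
have [F FP totF|C [[Clin CS] C_max]] := @Zorn_bigcup M P.
  split=> [a u v [X FX Xu] [Y FY Yv]|z [X /FP[_ XS] Xz]]; last exact: XS.
  have [XY|YX] := totF X Y FX FY.
    by exists Y => //; apply: (FP _ FY).1 => //; exact: XY.
  by exists X => //; apply: (FP _ FX).1 => //; exact: YX.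
have C0 : C 0.
  apply: contrapT => nC0; apply: (C_max [set 0]).
    split=> [u Cu|/(_ 0 erefl)//]; case: nC0.
    by rewrite -(addNr u) -scaleN1r; exact: Clin.
  by split=> [a u v -> ->|z -> _//]; rewrite /= scaler0 addr0.
exists C; split=> // B [B0 Blin] CB; apply: contrapT => noz.
apply: (C_max B CB); split=> // z Bz Sz; apply: contrapT => z0.
by apply: noz; exists z.
Qed.

Lemma submoduleZ (S : set M) x a : submodule S -> S x -> S (ract x a).
Proof. by move=> [S0 Slin] Sx; rewrite -[ract x a]addr0; exact: Slin. Qed.

Lemma submoduleD (S : set M) x y : submodule S -> S x -> S y -> S (x + y).
Proof. by move=> [S0 Slin] Sx Sy; rewrite -[x]scale1r; exact: Slin. Qed.

Lemma submoduleN (S : set M) x : submodule S -> S x -> S (- x).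
Proof. by move=> subS Sx; rewrite -scaleN1r; exact: submoduleZ. Qed.

Definition orbit x : set M := [set y | exists a, y = ract x a].

Lemma submodule_orbit x : submodule (orbit x).
Proof.
split; first by exists 0; rewrite ract0r.
move=> a u v [b ->] [c ->]; exists (b * a + c).
by rewrite ractDr -ractA.
Qed.

Definition sum_orbit (C : set M) x : set M :=
  [set y | exists a c, C c /\ y = ract x a + c].

Lemma submodule_sum_orbit C x : submodule C -> submodule (sum_orbit C x).
Proof.
move=> subC; have [C0 Clin] := subC; split.
  by exists 0, 0; rewrite ract0r addr0.
move=> a _ _ [b [c [Cc ->]]] [b' [c' [Cc' ->]]].
exists (b * a + b'), (a *: c + c'); split; first exact: Clin.
by rewrite scalerDr addrACA ractDr -ractA.
Qed.

(** A uniserial submodule [x A] of largest length is a direct summand.  Outside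
    [x A + C] choose [y1] at a vertex [k] with [y1 * arrow k] inside, say
    [y1 * a = x * b + c].  The left chain condition compares [a] and [b].  If
    [b = d * a], then [y1 - x * d] is killed by [a] modulo [C], so it spans a
    submodule that is simple modulo [C] and enlarges [C] without meeting [x A],
    against maximality.  If [a = d * b], then either [d] is invertible and the
    first case applies, or [b] is invertible and [y1 A] would be longer than
    [x A], or [a] lies in the square of the radical and vanishes. *)
Lemma orbit_summand i x t C : submodule C ->
  ract x (e i) = x -> ract x (walk i t) <> 0 ->
  (forall y j, ract y (walk j t.+1) = 0) ->
  (forall z, C z -> orbit x z -> z = 0) ->
  (forall B : set M, submodule B -> C `<` B ->
     exists z, [/\ B z, orbit x z & z <> 0]) ->
  forall y, sum_orbit C x y.
Proof.
move=> subC xe xt Mt CX C_max y; set W := sum_orbit C x.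
have subW : submodule W by exact: submodule_sum_orbit.
have CW c : C c -> W c by move=> Cc; exists 0, c; rewrite ract0r add0r.
have XW a : W (ract x a) by exists a, 0; rewrite addr0; case: subC.
apply: contrapT => nWy.
have [j nWyj] : exists j, ~ W (ract y (e j)).
  apply: contrapT => noj; apply: nWy; rewrite [y]ract_sum_idem.
  apply: (big_ind W) => [|u v|k _]; [by case: subW|exact: submoduleD|].
  by apply: contrapT => nW; apply: noj; exists k.
(* descend along the walk from y to the last element outside W *)
have [k [y1 [ye nWy1 Wy1]]] : exists k y1,
    [/\ ract y1 (e k) = y1, ~ W y1 & W (ract y1 (arrow k))].
  pose Q s := `[< W (ract y (walk j s)) >].
  have exQ : exists s, Q s.
    have [T wT] := walk_nilpotent sys; exists T; apply/asboolP.
    by rewrite wT ract0r; case: subW.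
  case: (ex_minnP exQ) => -[|s] /asboolP Qs min_s; first by case: nWyj.
  exists (target j s), (ract y (walk j s)); split.
  - by rewrite ractA walk_target.
  - by move=> Ws; have := min_s s; rewrite ltnn => /(_ (asboolT Ws)).
  - by rewrite ractA -walk1 -walkD addn1.
have [a0 [c0 [Cc0 yaE0]]] := Wy1.
pose a := arrow k; pose n := after sys k.
have ea : e k * a = a by exact: (in_rad_arrow sys k).1.
have ae : a * e n = a by exact: arrow_after.
pose b := e i * a0 * e n; pose c := ract c0 (e n).
have Cc : C c by exact: submoduleZ.
have yaE : ract y1 a = ract x b + c.
  rewrite -ae -ractA yaE0 ractDl /b -mulrA -[ract x (e i * _)]ractA xe.
  by rewrite ractA.
have eb : e i * b = b by rewrite /b !mulrA (ser_idem sys).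
have be : b * e n = b by rewrite /b -mulrA (ser_idem sys).
clearbody b c.
have [d Cd] : exists d, C (ract (y1 - ract x d) a).
  have lift d : b = d * a -> exists d, C (ract (y1 - ract x d) a).
    move=> bE; exists d; rewrite ractDl ractNl ractA -bE yaE.
    by rewrite addrC addrA addNr add0r.
  have [[d /lift//]|[d0 aE0]] := ser_left sys be ae.
  pose d := e k * d0 * e i.
  have aE : a = d * b by rewrite /d -mulrA eb -mulrA -aE0 ea.
  have ed : e k * d = d by rewrite /d !mulrA (ser_idem sys).
  have de : d * e i = d by rewrite /d -mulrA (ser_idem sys).
  have [[v bv]|gb] := pselect (generates e i b).
    (* modulo C, x is a right multiple of y1 * a, so walk i t kills it *)
    case: xt; apply: CX; last by exists (walk i t).
    have [r rE] : rideal (walk k t.+1) (a * v * walk i t).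
      by apply: walk_in_radl; apply: in_radMr; exact: in_rad_arrow.
    rewrite -[walk i t](walk_source sys) -bv -mulrA -ractA.
    have -> : ract x b = ract y1 a - c by rewrite yaE addrK.
    rewrite ractDl ractA mulrA rE -ractA Mt ract0l add0r.
    by apply: submoduleZ => //; exact: submoduleN.
  have [gd|gd] := pselect (generates e k d).
    have [w [_ _ _ wd]] := generates_inv sys ed de gd.
    by apply: (lift w); rewrite aE mulrA wd.
  have [r bE] : rideal (arrow i) b by apply: in_rad_rideal; split.
  have a2 : rideal (walk k 2) a.
    rewrite aE bE mulrA -(walk1 sys i); apply: ridealM.
    by apply: walk_in_radl; split.
  exists 0; suff -> : a = 0 by rewrite ract0r; case: subC.
  apply: contrapT => a0'; apply: (@walk_strict _ _ _ sys k 1); by rewrite walk1.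
pose y2 := ract (y1 - ract x d) (e k).
have y2E : y2 = y1 - ract x (d * e k) by rewrite /y2 ractDl ractNl ractA ye.
have Cy2a : C (ract y2 a) by rewrite /y2 ractA ea.
have y2e : ract y2 (e k) = y2 by rewrite /y2 ractA (ser_idem sys).
have nWy2 : ~ W y2.
  move=> Wy2; apply: nWy1; rewrite -[y1](subrK (ract x (d * e k))) -y2E.
  exact: submoduleD.
have [||z [[s [c' [Cc' zE]]] [r zxE] z0]] := C_max (sum_orbit C y2).
- exact: submodule_sum_orbit.
- split=> [c1 Cc1|sub]; first by exists 0, c1; rewrite ract0r add0r.
  apply/nWy2/CW/sub; exists 1, 0; rewrite ract1 addr0; split=> //.
  by case: subC.
have y2s : ract y2 s = ract y2 (e k * s) by rewrite -ractA y2e.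
have [[v vE]|ns] := pselect (generates e k (e k * s)).
  apply: nWy2; rewrite -y2e -vE -ractA -y2s.
  have -> : ract y2 s = ract x r - c' by rewrite -zxE zE addrK.
  by apply: submoduleZ => //; apply: submoduleD => //; apply: CW; exact: submoduleN.
have [|r' r'E] := @in_rad_rideal _ _ _ sys k (e k * s).
  by split=> //; rewrite mulrA (ser_idem sys).
apply: z0; apply: CX; last by exists r.
rewrite zE y2s r'E -ractA; apply: submoduleD => //; exact: submoduleZ.
Qed.

(** The generator is moved to the representative of the class of its vertex, so
    that closed walks at [i0] can be recognised by equality of vertices. *)
Lemma indecomposable_cyclic : indecomposable M ->
  exists i x l, [/\ rep e i = i, ract x (e i) = x, forall y, orbit x y,
    (l <= colength sys i)%N &
    forall a, e i * a = a -> (ract x a = 0 <-> rideal (walk i l) a)].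
Proof.
move=> [M0 M_ind].
have [i [x [t [xe xt Mt]]]] := longest_orbit M0.
have [C [subC CX C_max]] := orbit_complement (submodule_orbit x).
have CXT := orbit_summand subC xe xt Mt CX C_max.
have xT y : orbit x y.
  have [|||C0] := M_ind _ _ (submodule_orbit x) subC.
  - apply/seteqP; split=> [z [Xz Cz]|z ->]; first exact: CX.
    by split; [case: (submodule_orbit x)|case: subC].
  - apply/seteqP; split=> // z _; have [a [c [Cc ->]]] := CXT z.
    by exists (ract x a); [exists a|exists c].
  - move=> /seteqP[/(_ (ract x (walk i t))) X0 _]; case: xt; apply: X0.
    by exists (walk i t).
  - have [a [c [Cc ->]]] := CXT y; exists a.
    by move: Cc; rewrite C0 => ->; rewrite addr0.
have [u [eu ue gu]] := isoc_rep sys i.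
have [v [ev ve uv vu]] := generates_inv sys eu ue gu.
pose j := rep e i; pose x' := ract x u.
have x'e : ract x' (e j) = x' by rewrite ractA ue.
have x'v : ract x' v = x by rewrite ractA uv.
have x'0 : x' <> 0 by move=> x'0; apply: xt; rewrite -x'v x'0 !ract0l.
have exl : exists l, ract x' (walk j l) == 0.
  by exists (colength sys j); rewrite walk_colength ract0r.
case: (ex_minnP exl) => l /eqP l0 min_l.
exists j, x', l; split=> //.
- by apply/esym/rep_isoc => //; exact: isoc_rep.
- by move=> y; have [a ->] := xT y; exists (v * a); rewrite -ractA x'v.
- by rewrite min_l // walk_colength ract0r.
move=> a ea; split=> [a0|[r ->]]; last by rewrite -ractA l0 ract0l.
have [->|/eqP an0] := eqVneq a 0; first by exists 0; rewrite mulr0.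
have [s [w [aE ew _ [w' ww']]]] :=
  walk_factor sys (mulr1 1) ea (mulr1 a) an0.
rewrite aE; apply/ridealM/rideal_walk/min_l/eqP.
by rewrite -walk_target -ww' mulrA -aE -ractA a0 ract0l.
Qed.


End IndecomposableModules.

(** * Positions of syzygies *)

Section SyzygyPositions.

Variables (f : nat -> nat) (l n : nat).
Hypothesis f_homo : {homo f : p q / (p <= q)%N}.
Hypothesis f_shift : forall p, f (p + n) = (f p + n)%N.
Hypotheses (n_gt0 : (0 < n)%N) (le_nl : (n <= l)%N) (le_lf : (l + n <= f 0)%N).

Variable pos : nat -> nat.
Hypotheses (pos0 : pos 0%N = 0%N) (pos1 : pos 1%N = l).
Hypothesis posSS : forall k, pos k.+2 = f (pos k).

Lemma pos_gap k : (pos k + n <= pos k.+1)%N.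
Proof.
suff [] : (pos k + n <= pos k.+1)%N /\ (pos k.+1 + n <= pos k.+2)%N by [].
elim: k => [|k [IH1 IH2]]; first by rewrite posSS pos0 pos1.
by split=> //; rewrite !posSS -f_shift; exact: f_homo.
Qed.

(** Take the least [N] meeting the two lower bounds.  One of them fails for
    [N - 1]; whichever it is, the gap [n] between consecutive positions and the
    monotonicity of [f] give both upper bounds. *)
Lemma shift_between k : exists N,
  [/\ (pos k < N * n)%N, (N * n <= pos k.+1)%N,
      (pos k.+1 < l + N * n)%N & (l + N * n <= pos k.+2)%N].
Proof.
pose Q N := (pos k < N * n)%N && (pos k.+1 < l + N * n)%N.
have exQ : exists N, Q N.
  exists (pos k.+1).+1; rewrite /Q.
  have le_N : ((pos k.+1).+1 <= (pos k.+1).+1 * n)%N by rewrite leq_pmulr.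
  rewrite (leq_trans le_N (leq_addl _ _)) andbT.
  apply: leq_trans le_N; rewrite ltnS.
  exact: leq_trans (leq_addr _ _) (pos_gap k).
case: (ex_minnP exQ) => N /andP[lt1 lt2] min_N.
have f_shiftM m : f (m * n)%N = (f 0 + m * n)%N.
  elim: m => [|m IHm]; first by rewrite mul0n addn0.
  by rewrite mulSn addnC f_shift IHm -addnA [(_ * _ + n)%N]addnC.
have gap1 := pos_gap k; have gap2 := pos_gap k.+1.
case: N lt1 lt2 min_N => [|N] lt1 lt2 min_N; first by rewrite mul0n in lt1.
have : ~~ Q N by apply/negP => /min_N; rewrite ltnn.
rewrite negb_and -!leqNgt => /orP leN; exists N.+1.
rewrite mulSn in lt1 lt2 *.
case: leN => leN; split=> //.
- lia.
- by have := f_homo leN; rewrite f_shiftM -posSS; lia.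
- lia.
- lia.
Qed.

End SyzygyPositions.

(** * Self-extensions of a cyclic module *)

Section CyclicModule.

Variables (A : nzRingType) (I : finType) (e : I -> A).
Hypothesis sys : serial_system e.
Variables (M : lmodType A^c) (i0 : I) (x : M) (l : nat).

Local Notation walk := (walk sys).
Local Notation target := (target sys).
Local Notation colength := (colength sys).

Hypothesis rep_i0 : rep e i0 = i0.
Hypothesis xe : ract x (e i0) = x.
Hypothesis x_gen : forall y : M, exists a, y = ract x a.
Hypothesis le_l : (l <= colength i0)%N.
Hypothesis x_ann : forall a, e i0 * a = a ->
  (ract x a = 0 <-> rideal (walk i0 l) a).

Local Notation idx := (target i0).

Definition cover_end p : nat := (p + colength (idx p))%N.

Lemma cover_end_homo : {homo cover_end : p q / (p <= q)%N}.
Proof.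
move=> p q; elim: q => [|q IHq]; first by rewrite leqn0 => /eqP->.
rewrite leq_eqVlt => /orP[/eqP->//|/IHq le_pq]; apply: leq_trans le_pq _.
by rewrite /cover_end addSnnS leq_add2l colength_after.
Qed.

(** Two consecutive positions at a time, as [syz k.+2] depends on [syz k]. *)
Fixpoint syz_pair k : nat * nat :=
  if k is k'.+1 then let: (p, q) := syz_pair k' in (q, cover_end p) else (0%N, l).

Definition syz k : nat := (syz_pair k).1.

Lemma syzSS k : syz k.+2 = cover_end (syz k).
Proof. by rewrite /syz /=; case: (syz_pair k). Qed.

Lemma syz_le k : (syz k <= syz k.+1)%N.
Proof.
suff [] : (syz k <= syz k.+1)%N /\ (syz k.+1 <= syz k.+2)%N by [].
elim: k => [|k [IH1 IH2]]; first by rewrite syzSS.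
by split=> //; rewrite !syzSS; exact: cover_end_homo.
Qed.

Definition syz_width k : nat := (syz k.+1 - syz k)%N.

Lemma syz_width_le k : (syz_width k <= colength (idx (syz k)))%N.
Proof. by rewrite leq_subLR -/(cover_end _) -syzSS syz_le. Qed.

Definition syz_step k : A := walk (idx (syz k)) (syz_width k).

Lemma idx_syz_width k : target (idx (syz k)) (syz_width k) = idx (syz k.+1).
Proof. by rewrite targetD subnKC ?syz_le. Qed.

Lemma syz_step_target k : syz_step k * e (idx (syz k.+1)) = syz_step k.
Proof. by rewrite -idx_syz_width walk_target. Qed.

Definition res_pim k : lmodType A^c := @pim A^c (e (idx (syz k))).

Definition res_step_elt k : res_pim k :=
  @pim_elt A^c (e (idx (syz k))) (syz_step k) (walk_source sys _ _).

Definition res_step k : {linear res_pim k.+1 -> res_pim k} :=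
  @pim_hom A^c (e (idx (syz k.+1))) (res_pim k) (res_step_elt k).

Lemma res_stepE k y : pim_val (res_step k y) = syz_step k * pim_val y.
Proof. by []. Qed.

Lemma res_pim_source k (y : res_pim k) : e (idx (syz k)) * pim_val y = pim_val y.
Proof. exact: (@pim_valE A^c). Qed.

Definition res_cover : {linear res_pim 0 -> M} := @pim_hom A^c (e i0) M x.

Lemma res_coverE y : res_cover y = ract x (pim_val y).
Proof. by []. Qed.

Lemma res_elt k a : exists y : res_pim k, pim_val y = e (idx (syz k)) * a.
Proof.
have h : e (idx (syz k)) * (e (idx (syz k)) * a) = e (idx (syz k)) * a.
  by rewrite mulrA (ser_idem sys).
by exists (@pim_elt A^c _ _ h).
Qed.

Lemma range_res_step k (y : res_pim k) :
  range (res_step k) y <-> rideal (syz_step k) (pim_val y).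
Proof.
split=> [[z _ <-]|[r yE]]; first by exists (pim_val z).
have [z zE] := res_elt k.+1 r; exists z => //; apply: pim_val_inj.
by rewrite res_stepE zE mulrA syz_step_target yE.
Qed.

Lemma res_cover_surj : range res_cover = setT.
Proof.
apply/seteqP; split=> // y _; have [a ->] := x_gen y.
have [z zE] := res_elt 0 a; exists z => //.
by rewrite res_coverE zE -ractA xe.
Qed.

Lemma res_cover_exact : range (res_step 0) = [set y | res_cover y = 0].
Proof.
have step0 : syz_step 0 = walk i0 l by rewrite /syz_step /syz_width subn0.
have annE (y : res_pim 0) := x_ann (res_pim_source y).
apply/seteqP; split=> y; first by move/range_res_step; rewrite step0 => /annE.
by move=> /annE y0; apply/range_res_step; rewrite step0.
Qed.

Lemma res_step_exact k : range (res_step k.+1) = [set y | res_step k y = 0].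
Proof.
have colE : (colength (idx (syz k)) - syz_width k = syz_width k.+1)%N.
  by rewrite /syz_width syzSS /cover_end subnBA ?syz_le // addnC.
apply/seteqP; split=> y /=.
  move/range_res_step => [r yE]; apply: pim_val_inj; rewrite res_stepE yE mulrA.
  rewrite /syz_step -idx_syz_width -walkD.
  have /eqP-> : walk (idx (syz k)) (syz_width k + syz_width k.+1) == 0.
    by rewrite walk_eq0 -colE subnKC ?syz_width_le.
  by rewrite mul0r.
move=> /(congr1 (@pim_val _ _)); rewrite res_stepE => y0.
apply/range_res_step; have := @walk_annihilator _ _ _ sys (idx (syz k))
  (syz_width k) (pim_val y) (syz_width_le k).
by rewrite idx_syz_width colE; apply=> //; exact: res_pim_source.
Qed.

Lemma res_pim_projective k : projective (res_pim k).
Proof. exact: (@pim_projective A^c _ (ser_idem sys _)). Qed.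

Definition serial_resolution : projective_resolution M :=
  ProjectiveResolution res_pim_projective res_cover_surj res_cover_exact
    res_step_exact.

(** A cocycle in degree [k.+1] sends the generator of the [k.+1]-st term to
    [x * m]; it is closed when [m * syz_step k.+1] lies in the annihilator of
    [x], and it is a coboundary when [m] is a left multiple of [syz_step k]
    modulo the annihilator of [x]. *)
Definition ext_class k (m : A) : Prop :=
  [/\ e i0 * m = m, m * e (idx (syz k.+1)) = m,
      rideal (walk i0 l) (m * syz_step k.+1) &
      forall t r, m <> t * syz_step k + walk i0 l * r].

Lemma Ext_neq0_class k : Ext_neq0 k.+1 M M <-> exists m, ext_class k m.
Proof.
have xl : ract x (walk i0 l) = 0.
  by apply/x_ann; [exact: walk_source|exact: rideal_id].
rewrite (Ext_neq0P _ serial_resolution); split.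
  move=> [f [fd fnb]].
  pose g := @pim_gen A^c _ (ser_idem sys (idx (syz k.+1))) : res_pim k.+1.
  have fE y : f y = ract (f g) (pim_val y).
    exact: (@pim_hom_gen A^c _ (ser_idem sys _) M f y).
  have fge : ract (f g) (e (idx (syz k.+1))) = f g by rewrite [RHS]fE.
  have [m0 fg] := x_gen (f g).
  pose m := e i0 * m0 * e (idx (syz k.+1)).
  have xm : f g = ract x m by rewrite /m -mulrA -ractA xe -ractA -fg fge.
  exists m; split.
  - by rewrite /m !mulrA (ser_idem sys).
  - by rewrite /m -mulrA (ser_idem sys).
  - apply/x_ann; first by rewrite /m !mulrA (ser_idem sys).
    have := fd (@pim_gen A^c _ (ser_idem sys (idx (syz k.+2))) : res_pim k.+2).
    by rewrite fE xm ractA [pim_val _]res_stepE [pim_val _]/= syz_step_target.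
  move=> t r mE; apply: fnb.
  exists (@pim_hom A^c _ M (ract x t) : {linear res_pim k -> M}) => y.
  rewrite fE xm mE ractDr ractDl -(ractA x (walk _ _)) xl !ract0l addr0.
  by rewrite -ractA ractA.
move=> [m [em me [r mr] nm]].
exists (@pim_hom A^c _ M (ract x m) : {linear res_pim k.+1 -> M}); split.
  move=> y; rewrite -[LHS]/(ract (ract x m) (pim_val (res_step k.+1 y))).
  by rewrite res_stepE ractA mulrA mr -mulrA -ractA xl ract0l.
move=> [g gE].
pose u := @pim_gen A^c _ (ser_idem sys (idx (syz k))) : res_pim k.
have [t gu] := x_gen (g u).
have gE' y : g y = ract (g u) (pim_val y).
  exact: (@pim_hom_gen A^c _ (ser_idem sys _) M g y).
have := gE (@pim_gen A^c _ (ser_idem sys (idx (syz k.+1))) : res_pim k.+1).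
rewrite gE' gu -[LHS]/(ract (ract x m) (e (idx (syz k.+1)))).
rewrite [pim_val _]res_stepE [pim_val _]/= syz_step_target ractA me ractA => xmt.
pose z := m - e i0 * t * syz_step k.
have ez : e i0 * z = z by rewrite mulrBr em !mulrA (ser_idem sys).
have xz : ract x z = 0.
  by rewrite ractDr -mulrN -!mulrA -(ractA x (e i0)) xe mulrN xmt -ractDr subrr ract0r.
have [r' r'E] := (x_ann ez).1 xz.
by apply: (nm (e i0 * t) r'); rewrite -r'E /z addrC subrK.
Qed.

Lemma rep_idx p : rep e (idx p) = idx p.
Proof. by case: p => [//|p]; exact: rep_after. Qed.

(** The class [m] is a walk of length [k < l] up to an isomorphism.  As [m] is
    not a left multiple of [a = walk i0 l], the left chain condition gives
    [a = t * m] with [t] an endomorphism of [e i0 * A]; comparing lengths, [t] is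
    a closed walk of length [n = l - k].  The cocycle condition bounds
    [l + n]. *)
Lemma self_ext_period m : ext_class 0 m ->
  exists n, [/\ (0 < n <= l)%N, (l + n <= colength i0)%N & idx n = i0].
Proof.
have step0 : syz_step 0 = walk i0 l by rewrite /syz_step /syz_width subn0.
have step1 : syz_step 1 = walk (idx l) (colength i0 - l).
  by rewrite /syz_step /syz_width syzSS.
rewrite /ext_class step0 step1 => -[em me m_cocycle m_nb].
have m0 : m <> 0.
  by move=> m0; apply: (m_nb 0 0); rewrite m0 mul0r mulr0 addr0.
have [[r mE]|[t0 aE0]] := ser_left sys me (walk_target sys i0 l).
  by case: (m_nb r 0); rewrite mulr0 addr0.
pose t := e i0 * t0 * e i0.
have aE : walk i0 l = t * m by rewrite /t -!mulrA em -aE0 walk_source.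
have et : e i0 * t = t by rewrite /t !mulrA (ser_idem sys).
have te : t * e i0 = t by rewrite /t -mulrA (ser_idem sys).
have [k [u [mE eu ue gu]]] := walk_factor sys (ser_idem sys _) em me m0.
have kl : idx k = idx l.
  by apply: (rep_inj sys (rep_idx k) (rep_idx l)); exists u.
have lt_kl : (k < l)%N.
  rewrite ltnNge; apply/negP => le_lk.
  have [r wE] := rideal_walk sys i0 le_lk.
  by apply: (m_nb 0 (r * u)); rewrite mul0r add0r mulrA -wE.
have wk : walk i0 k <> 0 by move=> wk; apply: m0; rewrite mE wk mul0r.
have le_lw : (l <= k + (colength i0 - l))%N.
  rewrite leqNgt; apply/negP => lt_wl.
  have lt_wc := leq_trans lt_wl le_l.
  have wkw : walk (idx k) (colength i0 - l) <> 0.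
    by move=> w0; apply: (walk_neq0 lt_wc); rewrite walkD w0 mulr0.
  have uek : u * e (idx k) = u by rewrite kl.
  have [u' [_ _ [v u'v] uw]] := generates_walk eu uek gu wkw.
  suff /(walk_leq (walk_neq0 lt_wc)) : rideal (walk i0 l)
      (walk i0 (k + (colength i0 - l))) by rewrite leqNgt lt_wl.
  have -> : walk i0 (k + (colength i0 - l)) =
      m * walk (idx l) (colength i0 - l) * v.
    by rewrite mE -kl -(mulrA (walk i0 k)) uw -!mulrA u'v walk_target walkD.
  exact: ridealM.
have lt_lc : (l < colength i0)%N by lia.
have t0' : t <> 0 by move=> t0'; apply: (walk_neq0 lt_lc); rewrite aE t0' mul0r.
have [n [u2 [tE eu2 u2e gu2]]] := walk_factor sys (ser_idem sys _) et te t0'.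
have idxn : idx n = i0.
  by apply: (rep_inj sys (rep_idx n) rep_i0); exists u2.
rewrite idxn in eu2 gu2.
have [u3 [_ u3e gu3 u3E]] := generates_walk eu2 u2e gu2 wk.
have [v uv] := generatesM u3e gu3 gu.
have wE : walk i0 l = walk i0 (n + k) * (u3 * u).
  by rewrite aE tE mE mulrA -(mulrA _ u2) u3E walkD idxn !mulrA.
have wE' : walk i0 (n + k) = walk i0 l * v.
  have idxnk : idx (n + k) = idx k by rewrite -targetD idxn.
  by rewrite wE -[RHS]mulrA uv -idxnk walk_target.
have le1 : (n + k <= l)%N.
  by apply: (walk_leq (walk_neq0 lt_lc)); rewrite wE; exact/ridealM/rideal_id.
have le2 : (l <= n + k)%N.
  apply: (@walk_leq _ _ _ sys i0); last by rewrite wE'; exact/ridealM/rideal_id.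
  by move=> w0; apply: (walk_neq0 lt_lc); rewrite wE w0 mul0r.
by exists n; split=> //; lia.
Qed.

(** By periodicity the walk from position [N * n] to [syz k.+1] starts at
    [i0].  It is a cocycle because its product with the next differential
    reaches beyond [l + N * n]; it is not a coboundary because it is shorter
    than [l] and than the differential before it, and sums and left multiples of
    longer walks stay deeper in the radical filtration. *)
Lemma ext_class_shift n k : (0 < n <= l)%N -> (l + n <= colength i0)%N ->
  idx n = i0 -> exists m, ext_class k m.
Proof.
move=> /andP[n_gt0 le_nl] le_lc idxn.
have idx_shift p : idx (p + n) = idx p by rewrite addnC -targetD idxn.
have idx_shiftM N : idx (N * n) = i0.
  by elim: N => [//|N IHN]; rewrite mulSn addnC idx_shift.
have cover_shift p : cover_end (p + n) = (cover_end p + n)%N.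
  by rewrite /cover_end idx_shift addnAC.
have [N [lt1 le1 lt2 le2]] := shift_between cover_end_homo cover_shift n_gt0 le_nl
  (le_lc : (l + n <= cover_end 0)%N) (erefl : syz 0 = 0%N) (erefl : syz 1 = l) syzSS k.
set q := (N * n)%N in lt1 le1 lt2 le2.
have idxE p : (q <= p)%N -> target i0 (p - q) = idx p.
  by move=> le_qp; rewrite -[in LHS](idx_shiftM N) targetD subnKC.
have lt_c : (syz k.+1 - q < colength i0)%N.
  by apply: leq_trans le_l; rewrite ltn_subLR // addnC.
exists (walk i0 (syz k.+1 - q)); split.
- exact: walk_source.
- by rewrite -idxE // walk_target.
- rewrite /syz_step -idxE // -walkD; apply: rideal_walk.
  have := syz_le k.+1; rewrite /syz_width; lia.
move=> t r mE; apply: (walk_strict (walk_neq0 lt_c)).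
have [|r1 r1E] := walk_mull sys (idx (syz k)) (syz_width k)
    (_ : e i0 * (e i0 * t) = e i0 * t).
  by rewrite mulrA (ser_idem sys).
have [|r2 r2E] := rideal_walk sys i0 (_ : (syz k.+1 - q).+1 <= syz_width k)%N.
  by rewrite /syz_width; lia.
have [|r3 r3E] := rideal_walk sys i0 (_ : (syz k.+1 - q).+1 <= l)%N; first by lia.
exists (r2 * r1 + r3 * r).
rewrite -[LHS](walk_source sys) mE mulrDr !mulrA walk_source r1E r2E r3E.
by rewrite mulrDr !mulrA.
Qed.

End CyclicModule.

Theorem theorem0p3 (K : fieldType) (A : falgType K) (M : lmodType A^c)
  (nakA : nakayama A) (fgM : finitely_generated M) (indM : indecomposable M)
  (ext1 : Ext_neq0 1 M M) :
  forall i : nat, (1 <= i)%N -> Ext_neq0 i M M.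
Proof.
have [m [e sys]] := nakayama_serial nakA.
have [i0 [x [l [rep_i0 xe x_gen le_l x_ann]]]] := indecomposable_cyclic sys indM.
have classP := Ext_neq0_class xe x_gen le_l x_ann.
have [c /(self_ext_period rep_i0 le_l)[n [n_l l_n idxn]]] := (classP 0%N).1 ext1.
by case=> // k _; apply/classP; exact: (ext_class_shift le_l k n_l l_n idxn).
Qed.
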